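(* Let $D^3=\{(\alpha_+',\alpha_+,\alpha_-')\in\mathbb{R}^3\,|\,\alpha_+'^2+\alpha_+^2+\alpha_-'^2\le1\}$ be the compactified moduli space of geometric superalgebras described in the context. The compactified moduli space $\widehat{\mathcal{C}_0}$ of geometric supersymmetries is parametrized by the 2-disc $$\{(\alpha_+',\alpha_+,\alpha_-')\in D^3\,|\,\alpha_+=-3\alpha_+'\}.$$
   Context: For $(\alpha_-,\alpha_+',\alpha_+,\alpha_-')\in\mathbb{R}^4$ consider the eleven-dimensional Cahen-Wallach space $M_B$ with metric $g_B=2dx^+dx^--\sum_{i=1}^9B_{ii}(x^i)^2(dx^-)^2+\sum_{i=1}^9(dx^i)^2$, where $$B=-\mathrm{diag}\big((\alpha_--\alpha_+')^2\mathbf 1_2,(\alpha_-+\alpha_+')^2\mathbf 1_2,(\alpha_+-\alpha_+')^2\mathbf 1_1,(\alpha_++\alpha_+')^2\mathbf 1_4\big),$$ together with the spinor connection $D$ defined by the pair of Clifford elements $\bar c=(\alpha_+X^+_{1234}+\alpha_-X^-_{1234})\Gamma_{125}$, $d=(\alpha_+'X^+_{1234}+\alpha_-'X^-_{1234})\Gamma_{125}$, $X^\pm_{1234}=\tfrac12(\mathbf 1\pm\Gamma_{1234})$. Each such datum with $M_B$ indecomposable (i.e. $\alpha_-\neq\pm\alpha_+'$, $\alpha_+\neq\pm\alpha_+'$) defines a geometric superalgebra. Among these, the geometric supersymmetries (those superalgebras that are Lie superalgebras) are the data of the form $$B=-\mathrm{diag}\big((\alpha_--\alpha_+')^2\mathbf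 1_2,(\alpha_-+\alpha_+')^2\mathbf 1_2,16\alpha_+'^2\mathbf 1_1,4\alpha_+'^2\mathbf 1_4\big),$$ $$\bar c=(-3\alpha_+'X^+_{1234}+\alpha_-X^-_{1234})\Gamma_{125},\quad d=(\alpha_+'X^+_{1234}+\alpha_-'X^-_{1234})\Gamma_{125}.$$ The moduli space $\mathcal{C}$ of geometric superalgebras is the set of parameters with $M_B$ indecomposable modulo multiplication by positive real scalars and modulo $(\alpha_-,\alpha_+',\alpha_+,\alpha_-')\sim(-\alpha_-,\alpha_+',\alpha_+,\alpha_-')$. Normalizing to $\alpha_-^2+\alpha_+'^2+\alpha_+^2+\alpha_-'^2=1$ and $\alpha_-\ge0$, a class is represented by $(\alpha_+',\alpha_+,\alpha_-')$ with $\alpha_-=\sqrt{1-\alpha_+^2-\alpha_+'^2-\alpha_-'^2}$, and $\mathcal{C}=D^3\setminus\{\alpha_+=\pm\alpha_+'\text{ or }\alpha_+^2+2\alpha_+'^2+\alpha_-'^2=1\}$. Its compactification $\widehat{\mathcal{C}}=D^3$ is obtained by adding the decomposable configurations. The moduli space $\mathcal{C}_0\subset\mathcal{C}$ of geometric supersymmetries consists of the classes of geometric supersymmetries, and its compactification $\widehat{\mathcal{C}_0}\subset\widehat{\mathcal{C}}$ is obtained by adding the corresponding decomposable configurations (the closure of $\mathcal{C}_0$ in $D^3$). *)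

(* Defs.v *)
From HB Require Import structures.
From mathcomp Require Import all_boot all_order all_algebra.
From mathcomp Require Import all_classical all_reals all_analysis.
From mathcomp Require Import ring lra.
Import Order.TTheory GRing.Theory Num.Theory numFieldNormedType.Exports.

Set Implicit Arguments.
Unset Strict Implicit.
Unset Printing Implicit Defensive.

Local Open Scope classical_set_scope.
Local Open Scope ring_scope.

Record params (R : realType) := Params {
  alpha_m : R;
  alpha_p' : R;
  alpha_p : R;
  alpha_m' : R }.

(* The generators Gamma_1, ..., Gamma_9 of the transverse directions of M_B,
   in an arbitrary real algebra (the Clifford algebra, or the endomorphisms
   of a spinor module).  The bool s selects the sign convention
   Gamma_i ^+ 2 = +1 or Gamma_i ^+ 2 = -1. *)
Definition clifford_relations (R : realType) (A : algType R) (s : bool)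
    (Gamma : 'I_9 -> A) : Prop :=
  forall i j : 'I_9,
    Gamma i * Gamma j + Gamma j * Gamma i = ((-1) ^+ s * (i == j)%:R *+ 2)%:A.

Section CliffordElements.
Variables (R : realType) (A : algType R) (Gamma : 'I_9 -> A).

(* Gamma_k with the 1-based index k = 1, ..., 9. *)
Let G (k : nat) : A := Gamma (inord k.-1).

Definition Gamma_1234 : A := G 1 * G 2 * G 3 * G 4.
Definition Gamma_125 : A := G 1 * G 2 * G 5.
Definition Xp_1234 : A := 2^-1 *: (1 + Gamma_1234).
Definition Xm_1234 : A := 2^-1 *: (1 - Gamma_1234).

Definition cliff_elt (a b : R) : A :=
  (a *: Xp_1234 + b *: Xm_1234) * Gamma_125.

End CliffordElements.

(* - diag (b1 1_2, b2 1_2, b3 1_1, b4 1_4). *)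
Definition cw_matrix (R : realType) (b1 b2 b3 b4 : R) : 'M[R]_9 :=
  - diag_mx (\row_(i < 9) if (i < 2)%N then b1 else if (i < 4)%N then b2
                          else if (i < 5)%N then b3 else b4).

(* The matrix B, which determines the metric g_B of M_B, and the pair of
   Clifford elements (cbar, d), which determines the spinor connection D. *)
Record datum (R : realType) (A : algType R) := Datum {
  datum_B : 'M[R]_9;
  datum_cbar : A;
  datum_d : A }.

Section ModuliSpaces.
Variables (R : realType) (A : algType R) (Gamma : 'I_9 -> A).
Implicit Types (p q : params R) (x : R * R * R).

Definition datum_of p : datum A :=
  Datum
    (cw_matrix ((alpha_m p - alpha_p' p) ^+ 2) ((alpha_m p + alpha_p' p) ^+ 2)
               ((alpha_p p - alpha_p' p) ^+ 2) ((alpha_p p + alpha_p' p) ^+ 2))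
    (cliff_elt Gamma (alpha_p p) (alpha_m p))
    (cliff_elt Gamma (alpha_p' p) (alpha_m' p)).

Definition indecomposable p : Prop :=
  [/\ alpha_m p <> alpha_p' p, alpha_m p <> - alpha_p' p,
      alpha_p p <> alpha_p' p & alpha_p p <> - alpha_p' p].

Definition geometric_superalgebras : set (params R) := [set p | indecomposable p].

(* The geometric superalgebras that are Lie superalgebras are specified through
   the normal form of their data, not through the Jacobi identities. *)
Definition supersymmetric_form (X : datum A) : Prop :=
  exists am ap' am' : R,
    X = Datum
          (cw_matrix ((am - ap') ^+ 2) ((am + ap') ^+ 2)
                     (16 * ap' ^+ 2) (4 * ap' ^+ 2))
          (cliff_elt Gamma (- 3 * ap') am)
          (cliff_elt Gamma ap' am').

Definition geometric_supersymmetries : set (params R) :=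
  [set p | indecomposable p /\ supersymmetric_form (datum_of p)].

Definition equiv_params p q : Prop :=
  exists (t : R) (s : bool), 0 < t /\
    q = Params (t * ((-1) ^+ s * alpha_m p)) (t * alpha_p' p)
               (t * alpha_p p) (t * alpha_m' p).

Definition class_of p : set (params R) := [set q | equiv_params p q].

(* Moduli spaces are sets of equivalence classes. *)
Definition moduli : set (set (params R)) := class_of @` geometric_superalgebras.
Definition moduli0 : set (set (params R)) :=
  class_of @` geometric_supersymmetries.

(* Points of D^3 are triples (alpha_+', alpha_+, alpha_-'). *)
Definition D3 : set (R * R * R) :=
  [set x | x.1.1 ^+ 2 + x.1.2 ^+ 2 + x.2 ^+ 2 <= 1].

Definition representative x : params R :=
  Params (Num.sqrt (1 - x.1.2 ^+ 2 - x.1.1 ^+ 2 - x.2 ^+ 2)) x.1.1 x.1.2 x.2.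

Definition in_D3 (M : set (set (params R))) : set (R * R * R) :=
  [set x | D3 x /\ M (class_of (representative x))].

Definition compactified_moduli0 : set (R * R * R) :=
  closure (in_D3 moduli0) `&` D3.

End ModuliSpaces.

Section ModuliChart.
Variable R : realType.
Implicit Types (p q : params R) (x y : R * R * R).

Lemma equiv_params_refl p : equiv_params p p.
Proof. by exists 1, false; case: p => a b c d /=; rewrite expr0 !mul1r. Qed.

Lemma equiv_params_sym p q : equiv_params p q -> equiv_params q p.
Proof.
case=> t [s [t0 ->]]; exists t^-1, s; split; first by rewrite invr_gt0.
case: p => a b c d /=; have tn0 : t != 0 by rewrite gt_eqF.
by congr Params; rewrite ?mulKf // (mulrCA _ t) mulKf // signrMK.
Qed.

Lemma equiv_params_trans p q r :
  equiv_params p q -> equiv_params q r -> equiv_params p r.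
Proof.
move=> [t [s [t0 ->]]] [u [s' [u0 ->]]]; exists (u * t), (s' (+) s).
split; first by rewrite mulr_gt0.
by rewrite /= signr_addb; congr Params; ring.
Qed.

Lemma class_ofP p q : class_of p = class_of q <-> equiv_params p q.
Proof.
split=> [E|pq].
  have : class_of q q by exact: equiv_params_refl.
  by rewrite -E.
apply/seteqP; split=> r /= h.
  by apply: equiv_params_trans h; exact: equiv_params_sym.
exact: equiv_params_trans h.
Qed.

Lemma equiv_indecomposable p q :
  equiv_params p q -> indecomposable p -> indecomposable q.
Proof.
case=> t [s [t0 ->]] [] h1 h2 h3 h4.
have tI : injective ( *%R t) by apply: mulfI; rewrite gt_eqF.
by case: s; split; rewrite /= ?expr0 ?expr1 -?mulrN => /tI; lra.
Qed.

Lemma moduli_class_of p : @moduli R (class_of p) <-> indecomposable p.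
Proof.
split=> [[q hq /class_ofP e]|hp]; last by exists p.
exact: equiv_indecomposable e hq.
Qed.

Lemma in_D3_moduli : in_D3 (@moduli R) =
  @D3 R `\` [set x | x.1.2 = x.1.1 \/ x.1.2 = - x.1.1 \/
                  x.1.2 ^+ 2 + 2 * x.1.1 ^+ 2 + x.2 ^+ 2 = 1].
Proof.
apply/seteqP; split=> -[[b c] d]; rewrite /in_D3 /D3 /=.
  case=> xD /moduli_class_of[] /=.
  have : 0 <= 1 - c ^+ 2 - b ^+ 2 - d ^+ 2 by lra.
  move=> /sqr_sqrtr; set a := Num.sqrt _ => aE h1 h2 h3 h4; split=> // -[|[]] //.
  move=> e; have /eqP : a ^+ 2 = b ^+ 2 by lra.
  by rewrite eqf_sqr => /orP[]/eqP.
case=> xD h; split=> //; apply/moduli_class_of.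
have : 0 <= 1 - c ^+ 2 - b ^+ 2 - d ^+ 2 by lra.
split=> /= e; apply: h; move: (sqr_sqrtr H) => //; rewrite ?e; [| |tauto|tauto].
- by move=> ?; right; right; lra.
- by rewrite sqrrN => ?; right; right; lra.
Qed.

Lemma moduli_unique_representative (X : set (params R)) :
  moduli X -> exists! x, D3 x /\ X = class_of (representative x).
Proof.
case=> -[a b c d] hp <-; set N := a ^+ 2 + b ^+ 2 + c ^+ 2 + d ^+ 2.
have N0 : 0 < N.
  case: hp => /= h1 h2 h3 h4.
  have ge : forall z : R, 0 <= z ^+ 2 by move=> z; exact: sqr_ge0.
  have : 0 <= N by rewrite /N !addr_ge0.
  rewrite le_eqVlt => /orP[/eqP N0|//]; exfalso.
  have a0 : a ^+ 2 == 0 by have := ge a; have := ge b; have := ge c; have := ge d; move: N0; rewrite /N; lra.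
  have b0 : b ^+ 2 == 0 by have := ge a; have := ge b; have := ge c; have := ge d; move: N0; rewrite /N; lra.
  by move: a0 b0; rewrite !sqrf_eq0 => /eqP a0 /eqP b0; apply: h1; rewrite a0.
set n := Num.sqrt N; have n0 : 0 < n by rewrite sqrtr_gt0.
have nn0 : n != 0 by rewrite gt_eqF.
have nE : n ^+ 2 = N by rewrite sqr_sqrtr // ltW.
exists (b / n, c / n, d / n); split.
  have E : 1 - (c / n) ^+ 2 - (b / n) ^+ 2 - (d / n) ^+ 2 = (a / n) ^+ 2.
    apply: (mulIf (expf_neq0 2 nn0)); rewrite !mulrBl mul1r -!exprMn !divfK //.
    by rewrite nE /N; ring.
  split; first by rewrite /D3 /=; have := sqr_ge0 (a / n); lra.
  apply/class_ofP; exists n^-1, (a < 0); split; first by rewrite invr_gt0.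
  rewrite /representative /= E sqrtr_sqr normrM (gtr0_norm (_ : 0 < n^-1)) ?invr_gt0 //.
  by rewrite -normrEsign; congr Params; rewrite mulrC.
move=> [[b' c'] d'] [yD /class_ofP [t [s [t0 [E1 Eb Ec Ed]]]]] /=.
move: yD E1; rewrite /D3 /= Eb Ec Ed => yD E1.
suff -> : t = n^-1 by congr (_, _, _); rewrite mulrC.
apply: (mulIf nn0); rewrite mulVf //; apply/eqP.
rewrite -(@eqrXn2 _ 2) ?mulr_ge0 ?ltW // expr1n exprMn nE; apply/eqP.
have h : 0 <= 1 - (t * c) ^+ 2 - (t * b) ^+ 2 - (t * d) ^+ 2 by lra.
have := sqr_sqrtr h; rewrite E1 !exprMn sqrr_sign /N; lra.
Qed.


End ModuliChart.

Definition disc2 (R : realType) : set (R * R) :=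
  [set u | u.1 ^+ 2 + u.2 ^+ 2 <= 1].

Definition homeomorphic_sets (S T : topologicalType) (A : set S) (B : set T) :
    Prop :=
  exists (f : S -> T) (g : T -> S),
    [/\ {within A, continuous f}, {within B, continuous g},
        (forall a, A a -> B (f a) /\ g (f a) = a) &
        (forall b, B b -> A (g b) /\ f (g b) = b)].

(* Main.v *)
Require Import Defs.
From mathcomp Require Import all_boot all_order all_algebra.
From mathcomp Require Import all_classical all_reals all_analysis.
From mathcomp Require Import ring lra.
Import Order.TTheory GRing.Theory Num.Theory numFieldNormedType.Exports.
Local Open Scope classical_set_scope.
Local Open Scope ring_scope.

(** The parameters [alpha_+'], [alpha_+] can be read off the Clifford elements
    [d], [cbar], because [(a, b) |-> (a X^+ + b X^-) Gamma_125] is injective in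
    any nonzero algebra with the Clifford relations ([cliff_elt_inj]).  A datum
    therefore has the normal form of a supersymmetry exactly when
    [alpha_+ = - 3 alpha_+'] ([supersymmetric_formE]).  This equation is
    homogeneous and does not mention [alpha_-], so it passes to classes, and
    [C_0] is the set of points of [C] on the plane [alpha_+ = - 3 alpha_+']
    ([in_D3_moduli0]).

    The plane section of [D^3] is closed, so it contains the closure of [C_0].
    Conversely, with [b = alpha_+'] and [d = alpha_-'], it is the solid ellipse
    [10 b^2 + d^2 <= 1], from which [C_0] omits only the line [b = 0] and the
    ellipse [11 b^2 + d^2 = 1].  From any point of the solid ellipse, the segment
    towards [(1/4, 0)] if [b >= 0], or [(-1/4, 0)] if [b < 0], avoids both curves
    for a while immediately after its start, so that every point is a limit of points of
    [C_0] ([plane_section_sub_closure]).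

    Rescaling [b] by [sqrt 10] maps the solid ellipse onto the unit disc. *)

(** * Injectivity of the Clifford elements *)

Section Clifford.
Variables (R : realType) (A : algType R) (s : bool) (Gamma : 'I_9 -> A).
Hypothesis hGamma : clifford_relations s Gamma.

Lemma clifford_sqr i : Gamma i * Gamma i = ((-1) ^+ s)%:A.
Proof.
have := hGamma i i; rewrite eqxx mulr1 -mulr2n -scalerMnl => h.
have n2 : (2 : R) != 0 by rewrite pnatr_eq0.
by apply: (scalerI n2); rewrite !scaler_nat.
Qed.

Lemma clifford_anticomm {i j} : i != j -> Gamma i * Gamma j = - (Gamma j * Gamma i).
Proof.
move=> /negPf ij; apply/eqP; rewrite -addr_eq0 hGamma ij.
by rewrite mulr0 mul0rn scale0r.
Qed.

(** [Gamma_i] squares to a unit, so it can be cancelled. *)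
Lemma clifford_mulIr0 i (x : A) : x * Gamma i = 0 -> x = 0.
Proof.
move=> h; have : x * (Gamma i * Gamma i) = 0 by rewrite mulrA h mul0r.
rewrite clifford_sqr -scalerAr mulr1 => /eqP.
by rewrite scaler_eq0 signr_eq0 => /eqP.
Qed.

Lemma inord_neq {m n : nat} : (m < 9)%N -> (n < 9)%N -> m != n ->
  inord m != inord n :> 'I_9.
Proof. by move=> hm hn; rewrite -val_eqE /= !inordK. Qed.

Lemma Gamma_1234_anticomm :
  Gamma_1234 Gamma * Gamma (inord 0) = - (Gamma (inord 0) * Gamma_1234 Gamma).
Proof.
rewrite /Gamma_1234 /=.
have swap (k : nat) (x : A) : (0 < k < 9)%N ->
    x * Gamma (inord k) * Gamma (inord 0) = - (x * Gamma (inord 0) * Gamma (inord k)).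
  move=> /andP[k0 k9]; rewrite -mulrA (clifford_anticomm (inord_neq k9 _ _)) //.
    by rewrite mulrN mulrA.
  by rewrite -lt0n.
by rewrite (swap 3%N) // (swap 2%N) // (swap 1%N) // !mulNr opprK !mulrA.
Qed.

(** [Gamma_1] commutes with the first term and anticommutes with the second, so
    multiplying by it on either side and adding isolates the first term. *)
Lemma one_Gamma_1234_free (u v : R) :
  u%:A + v *: Gamma_1234 Gamma = 0 -> u = 0 /\ v = 0.
Proof.
move=> h; set e := Gamma (inord 0).
have hl : e * (u%:A + v *: Gamma_1234 Gamma) = 0 by rewrite h mulr0.
have hr : (u%:A + v *: Gamma_1234 Gamma) * e = 0 by rewrite h mul0r.
have u0 : u = 0.
  have : (u *+ 2)%:A * e = 0.
    rewrite -[RHS]addr0 -{1}hl -hr mulrDr mulrDl -!scalerAr -!scalerAl.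
    rewrite Gamma_1234_anticomm -/e mulr1 !mul1r scalerN addrACA subrr addr0.
    by rewrite -scalerDl mulr2n.
  move=> /clifford_mulIr0/eqP; rewrite scaler_eq0 oner_eq0 orbF.
  by rewrite mulrn_eq0 => /eqP.
split=> //; move: h; rewrite u0 scale0r add0r => /eqP.
rewrite scaler_eq0 => /orP[/eqP //|/eqP h].
suff /eqP : (1 : A) = 0 by rewrite oner_eq0.
by do 4 apply: clifford_mulIr0; rewrite mul1r; exact: h.
Qed.

(** Once the product [Gamma_125] is cancelled, the two coefficients remain as
    half sum and half difference in front of [1] and [Gamma_1234]. *)
Lemma cliff_elt_inj (a b a' b' : R) :
  cliff_elt Gamma a b = cliff_elt Gamma a' b' -> a = a' /\ b = b'.
Proof.
move/eqP; rewrite -subr_eq0 /cliff_elt -mulrBl /Gamma_125 !mulrA => /eqP.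
do 3 move/clifford_mulIr0.
rewrite /Xp_1234 /Xm_1234.
set g := Gamma_1234 Gamma; set o := 1 : A.
have -> : a *: (2^-1 *: (o + g)) + b *: (2^-1 *: (o - g)) -
    (a' *: (2^-1 *: (o + g)) + b' *: (2^-1 *: (o - g))) =
    (2^-1 * ((a - a') + (b - b'))) *: o + (2^-1 * ((a - a') - (b - b'))) *: g.
  rewrite !scalerA !scalerDr !scalerN !opprD !opprK.
  have regroup (x y z t : R) :
      (x *: o + x *: g + (y *: o - y *: g)) +
      (- (z *: o) - z *: g + (- (t *: o) + t *: g)) =
      (x + y - z - t) *: o + (x - y - z + t) *: g.
    by rewrite !(scalerDl, scaleNr) !addrA [LHS](ACl (1*3*5*7*2*4*6*8)).
  by rewrite regroup; congr (_ *: _ + _ *: _); ring.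
by move/one_Gamma_1234_free => [] h1 h2; split; lra.
Qed.

Lemma supersymmetric_formE (p : params R) :
  supersymmetric_form Gamma (datum_of Gamma p) <-> alpha_p p = - 3 * alpha_p' p.
Proof.
case: p => a b c d; split=> [[am [ap' [am' []]]] _|] /=.
  by move=> /cliff_elt_inj[-> _] /cliff_elt_inj[-> _].
move=> ->; exists a, b, d; rewrite /datum_of /=.
by congr (Datum (cw_matrix _ _ _ _) _ _); ring.
Qed.

(** Equivalent parameters differ by a positive factor and a sign of [alpha_-],
    so the plane [alpha_+ = - 3 alpha_+'] does not depend on the representative
    of the class. *)
Lemma in_D3_moduli0 (x : R * R * R) :
  in_D3 (moduli0 Gamma) x <->
  D3 x /\ indecomposable (representative x) /\ x.1.2 = - 3 * x.1.1.
Proof.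
split=> [[xD [q [qi /supersymmetric_formE qs]]]|[xD [xi xs]]].
  move=> /class_ofP e; split=> //; split; first exact: equiv_indecomposable e qi.
  case: e => t [s' [t0 [_ -> -> _]]]; rewrite qs; ring.
split=> //; exists (representative x) => //; split=> //.
exact/supersymmetric_formE.
Qed.

End Clifford.

(** * Density in the plane section *)

Lemma continuous_pair {S T U : topologicalType} {f : S -> T} {g : S -> U} :
  continuous f -> continuous g -> continuous (fun x => (f x, g x)).
Proof. by move=> cf cg x; exact: (cvg_pair (cf x) (cg x)). Qed.

Section Density.
Variable R : realType.

Definition plane_section : set (R * R * R) :=
  [set x | D3 x /\ x.1.2 = - 3 * x.1.1].

Lemma closed_plane_section : closed plane_section.
Proof.
have c1 : continuous (fun x : R * R * R => x.1.1).
  by move=> x; apply: (cvg_comp _ _ cvg_fst); exact: cvg_fst.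
have c2 : continuous (fun x : R * R * R => x.1.2).
  by move=> x; apply: (cvg_comp _ _ cvg_fst); exact: cvg_snd.
have c3 : continuous (fun x : R * R * R => x.2) by move=> x; exact: cvg_snd.
have -> : plane_section =
  ((fun x : R * R * R => x.1.1 ^+ 2 + x.1.2 ^+ 2 + x.2 ^+ 2) @^-1` [set r | r <= 1])
  `&` ((fun x : R * R * R => x.1.2 - (- 3 * x.1.1)) @^-1` [set r | r = 0]).
  apply/seteqP; split=> x [/= xD h]; split=> //=; first by rewrite h subrr.
  by apply/eqP; rewrite -subr_eq0; apply/eqP.
apply: closedI; apply: closed_comp.
- move=> x _; apply: cvgD; last by apply: cvgM; exact: c3.
  by apply: cvgD; apply: cvgM; (exact: c1 || exact: c2).
- exact: closed_le.
- move=> x _; apply: cvgB; first exact: c2.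
  by apply: cvgM; [exact: cvg_cst|exact: c1].
- exact: closed_eq.
Qed.

(** The quantity [11 b^2 + d^2 - 1] is convex along the segment and negative at
    its end: if it is nonpositive at the start, it is negative afterwards, and
    if it is positive at the start, it stays positive for a while. *)
Lemma plane_section_sub_closure :
  plane_section `<=`
  closure [set x : R * R * R | D3 x /\ indecomposable (representative x) /\
                               x.1.2 = - 3 * x.1.1].
Proof.
move=> [[b c] d] [/= xD xc]; rewrite /= in xc; subst c.
have {xD} xD : 10 * b ^+ 2 + d ^+ 2 <= 1 by move: xD; rewrite /D3 /=; lra.
(* The segment ends at [(u, 0)], with [u] of the weak sign of [b]; the size 1/4
   puts this end inside both ellipses: [10 u^2 < 11 u^2 < 1]. *)
pose u : R := if 0 <= b then 4^-1 else - 4^-1.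
have u2 : u ^+ 2 = 16^-1 by rewrite /u; case: ifP => _; field.
have bu : 0 <= b * u.
  by rewrite /u; case: ifP => [b0|/negbT]; [lra|rewrite -ltNge; lra].
pose bt (t : R) := b + t * (u - b); pose dt (t : R) := d - t * d.
pose gam (t : R) : R * R * R := (bt t, - 3 * bt t, dt t).
pose q (t : R) := 11 * bt t ^+ 2 + dt t ^+ 2 - 1.
have cbt : continuous bt.
  move=> t; apply: cvgD; first exact: cvg_cst.
  by apply: cvgM; [exact: cvg_id|exact: cvg_cst].
have cdt : continuous dt.
  move=> t; apply: cvgB; first exact: cvg_cst.
  by apply: cvgM; [exact: cvg_id|exact: cvg_cst].
have cbct : continuous (fun t => (bt t, - 3 * bt t)).
  apply: continuous_pair; first exact: cbt.
  by move=> t; apply: cvgM; [exact: cvg_cst|exact: cbt].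
have cgam : continuous gam by exact: continuous_pair cbct cdt.
have cq : continuous q.
  move=> t; apply: cvgB; last exact: cvg_cst.
  apply: cvgD; last by apply: cvgM; exact: cdt.
  by apply: cvgM; [exact: cvg_cst|apply: cvgM; exact: cbt].
have gam0 : gam 0 = (b, - 3 * b, d) by rewrite /gam /bt /dt !mul0r addr0 subr0.
have q_neq0 : \forall t \near 0^'+, q t != 0.
  have [q0|q0] := leP (q 0) 0; last first.
    have q_gt0 : \forall t \near (0 : R), 0 < q t by exact: cvgr_gt (cq 0) _ q0.
    apply: (@cvg_within _ (nbhs (0 : R))).
    by apply: filterS q_gt0 => t; rewrite lt0r => /andP[].
  near=> t; have t0 : 0 < t by near: t; exact: nbhs_right_gt.
  have t1 : t < 1 by near: t; exact: nbhs_right_lt.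
  (* Convexity, with its defect made explicit. *)
  rewrite lt_eqF //; move: q0; rewrite /q /bt /dt.
  rewrite !mul0r addr0 subr0 => q0.
  have -> : 11 * (b + t * (u - b)) ^+ 2 + (d - t * d) ^+ 2 - 1 =
    (1 - t) * (11 * b ^+ 2 + d ^+ 2 - 1) + t * (11 * u ^+ 2 - 1)
    - t * (1 - t) * (11 * (u - b) ^+ 2 + d ^+ 2) by ring.
  rewrite u2; have := sqr_ge0 (u - b); have := sqr_ge0 d => h1 h2.
  have h3 : 0 <= t * (1 - t) * (11 * (u - b) ^+ 2 + d ^+ 2).
    by rewrite mulr_ge0 // ?mulr_ge0 //; lra.
  have h4 : (1 - t) * (11 * b ^+ 2 + d ^+ 2 - 1) <= 0.
    by rewrite mulr_ge0_le0 //; lra.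
  by lra.
have good : \forall t \near 0^'+, D3 (gam t) /\
    indecomposable (representative (gam t)) /\ (gam t).1.2 = - 3 * (gam t).1.1.
  near=> t; have t0 : 0 < t by near: t; exact: nbhs_right_gt.
  have t1 : t < 1 by near: t; exact: nbhs_right_lt.
  have qt : q t != 0 by near: t; exact: q_neq0.
  have bt0 : bt t != 0.
    (* [u bt] is a sum of nonnegative terms, the second of which is positive. *)
    rewrite -(mulrI_eq0 _ (mulfI (_ : u != 0))) -?(sqrf_eq0 u) ?u2 ?invr_eq0 ?pnatr_eq0 //.
    have -> : u * bt t = (1 - t) * (b * u) + t * u ^+ 2 by rewrite /bt; ring.
    have : 0 <= (1 - t) * (b * u) by rewrite mulr_ge0 //; lra.
    by rewrite u2 => ?; rewrite gt_eqF //; lra.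
  have gD : D3 (gam t).
    rewrite /D3 /gam /= /bt /dt.
    have -> : (b + t * (u - b)) ^+ 2 + (- 3 * (b + t * (u - b))) ^+ 2 +
        (d - t * d) ^+ 2 =
      (1 - t) * (10 * b ^+ 2 + d ^+ 2) + t * (10 * u ^+ 2)
      - t * (1 - t) * (10 * (u - b) ^+ 2 + d ^+ 2) by ring.
    rewrite u2; have := sqr_ge0 (u - b); have := sqr_ge0 d => h1 h2.
    have h3 : 0 <= t * (1 - t) * (10 * (u - b) ^+ 2 + d ^+ 2).
      by rewrite mulr_ge0 // ?mulr_ge0 //; lra.
    have h4 : (1 - t) * (10 * b ^+ 2 + d ^+ 2) <= (1 - t) * 1.
      by rewrite ler_wpM2l //; lra.
    by lra.
  split=> //; split=> //; apply/moduli_class_of.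
  suff [] : in_D3 (@moduli R) (gam t) by [].
  rewrite in_D3_moduli; split=> //= -[|[|]] e.
  - by move/eqP: bt0; apply; lra.
  - by move/eqP: bt0; apply; lra.
  - by move/eqP: qt; apply; rewrite /q; lra.
rewrite -gam0; apply: (@closed_cvg _ _ (0^'+) _ gam _ (@closed_closure _ _)).
- by apply: filterS good => t h; exact: subset_closure.
- by apply: cvg_at_right_filter; exact: cgam.
Unshelve. all: by end_near.
Qed.

End Density.

(** * The moduli space as a disc *)

Theorem proposition7p3 (R : realType) (A : algType R) (s : bool)
    (Gamma : 'I_9 -> A) (hGamma : clifford_relations s Gamma) :
  compactified_moduli0 Gamma = [set x | D3 x /\ x.1.2 = - 3 * x.1.1] /\
  homeomorphic_sets (compactified_moduli0 Gamma) (@disc2 R).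
Proof.
have E : compactified_moduli0 Gamma = plane_section R.
  have {1}-> : @compactified_moduli0 _ _ Gamma = closure [set x : R * R * R |
      D3 x /\ indecomposable (representative x) /\ x.1.2 = - 3 * x.1.1] `&` @D3 R.
    rewrite /compactified_moduli0; congr (closure _ `&` _).
    by apply/seteqP; split=> x /(in_D3_moduli0 _ _ _ _ hGamma).
  apply/seteqP; split=> [x [cx _]|x xP].
    apply: closed_plane_section; apply: closureS cx => y [yD [_ ye]]; by split.
  by split; [exact: plane_section_sub_closure|case: xP].
split; first exact: E.
rewrite E; set r : R := Num.sqrt 10.
have r2 : r ^+ 2 = 10 by rewrite sqr_sqrtr // ler0n.
have r0 : r != 0 by rewrite sqrtr_eq0 -ltNge ltr0n.
exists (fun x => (r * x.1.1, x.2)), (fun u => (u.1 / r, - 3 * (u.1 / r), u.2)).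
split.
- apply: continuous_subspaceT; apply: continuous_pair => x; last exact: cvg_snd.
  apply: cvgM; first exact: cvg_cst.
  by apply: (cvg_comp _ _ cvg_fst); exact: cvg_fst.
- have c1 : continuous (fun u : R * R => u.1 / r).
    by move=> u; apply: cvgM; [exact: cvg_fst|exact: cvg_cst].
  have c2 : continuous (fun u : R * R => (u.1 / r, - 3 * (u.1 / r))).
    apply: continuous_pair; first exact: c1.
    by move=> u; apply: cvgM; [exact: cvg_cst|exact: c1].
  apply: continuous_subspaceT; apply: continuous_pair; first exact: c2.
  by move=> u; exact: cvg_snd.
- move=> [[b c] d] [/= xD xc]; rewrite /= in xc; subst c; split.
    by move: xD; rewrite /D3 /disc2 /= (exprMn _ r) r2; lra.
  by rewrite mulrAC divff // mul1r.
- move=> [v d] /= vD; split; last by rewrite mulrC divfK.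
  split=> //=; move: vD; rewrite /D3 /disc2 /=.
  have -> : v ^+ 2 = 10 * (v / r) ^+ 2 by rewrite -r2 -exprMn mulrC divfK.
  by lra.
Qed.
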